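(* Let $0=t_0<t_1<\dots<t_k=\tau<T$, and let $\mathcal I_{\mathrm{obs}}=\{j_1,\dots,j_q\}$ and $\mathcal I_{\mathrm{obs}}'=\{j_1',\dots,j_q'\}$ be any two sets of minor agents' indices with the same cardinality $q$, each used as the major agent's observation set. Denote by $\mathcal I_{0,\mathrm{eff}}^{(k)}(\tau;\mathcal I_{\mathrm{obs}})$ and $\mathcal I_{0,\mathrm{eff}}^{(k)}(\tau;\mathcal I_{\mathrm{obs}}')$ the corresponding effective information matrices for $\theta=((e^0)^\top,\bar e^\top)^\top$, defined in the context, where it is assumed for each of the two observation sets that $\Sigma_s^0\succ0$ for $s=0,\dots,k-1$, $\mathcal I_{\eta\eta}^{(k)}\succ0$ and that the effective information matrix is positive definite. Then $$\mathcal I_{0,\mathrm{eff}}^{(k)}(\tau;\mathcal I_{\mathrm{obs}})=\mathcal I_{0,\mathrm{eff}}^{(k)}(\tau;\mathcal I_{\mathrm{obs}}').$$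
   Context: **Parameters.** $T>0$; $A,F,D\in\mathbb R^{d\times d}$, $G\in\mathbb R^{d\times d_0}$, $B\in\mathbb R^{d\times m}$, $A_0,D_0\in\mathbb R^{d_0\times d_0}$, $F_0\in\mathbb R^{d_0\times d}$, $B_0\in\mathbb R^{d_0\times m_0}$; symmetric $Q,\bar Q\in\mathbb R^{d\times d}$, $Q_0,\bar Q_0\in\mathbb R^{d_0\times d_0}$ positive semidefinite; $R\in\mathbb R^{m\times m}$, $R_0\in\mathbb R^{m_0\times m_0}$ symmetric positive definite; $\Gamma,\bar\Gamma\in\mathbb R^{d\times d}$, $\Lambda,\bar\Lambda\in\mathbb R^{d\times d_0}$, $\Gamma_0,\bar\Gamma_0\in\mathbb R^{d_0\times d}$, and vectors $\eta_c,\bar\eta_c\in\mathbb R^d$, $\eta_0,\bar\eta_0\in\mathbb R^{d_0}$. All parameters are common to all minor agents. Set $M:=BR^{-1}B^\top$, $M_0:=B_0R_0^{-1}B_0^\top$, $\Pi_0:=(I_{d_0},-\Gamma_0)$, $\bar\Pi_0:=(I_{d_0},-\bar\Gamma_0)$. **Riccati data.** Let $$A_1=\begin{pmatrix}A_0&F_0\\ G&A+F\end{pmatrix},\ \mathbb A=\begin{pmatrix}A_0&F_0&0\\ G&A+F&0\\ 0&0&A\end{pmatrix},\ \mathbb M=\begin{pmatrix}M_0&0&0\\ 0&0&M\end{pmatrix},$$ $$\mathcal Q=\begin{pmatrix}Q_0&-Q_0\Gamma_0\\ -\Gamma_0^\top Q_0&\Gamma_0^\top Q_0\Gamma_0\\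 -Q\Lambda&-Q(\Gamma-I_d)\end{pmatrix},\ \bar{\mathcal Q}=\begin{pmatrix}\bar Q_0&-\bar Q_0\bar\Gamma_0\\ -\bar\Gamma_0^\top\bar Q_0&\bar\Gamma_0^\top\bar Q_0\bar\Gamma_0\\ -\bar Q\bar\Lambda&-\bar Q(\bar\Gamma-I_d)\end{pmatrix},\ \nu=\begin{pmatrix}\Pi_0^\top Q_0\eta_0\\ Q\eta_c\end{pmatrix},\ \bar\nu=\begin{pmatrix}\bar\Pi_0^\top\bar Q_0\bar\eta_0\\ \bar Q\bar\eta_c\end{pmatrix}.$$ $P_t\in\mathbb R^{(d_0+2d)\times(d_0+d)}$, $\mathcal G_t\in\mathbb R^{d_0+2d}$, $P_t^x\in\mathbb R^{d\times d}$ solve on $[0,T]$ $$-\dot P_t=\mathbb A^\top P_t+P_tA_1-P_t\mathbb MP_t+\mathcal Q,\ P_T=\bar{\mathcal Q};\qquad \dot{\mathcal G}_t=-\big((\mathbb A^\top-P_t\mathbb M)\mathcal G_t-\nu\big),\ \mathcal G_T=-\bar\nu;$$ $$-\dot P_t^x=A^\top P_t^x+P_t^xA-P_t^xMP_t^x+Q,\ P_T^x=\bar Q.$$ Standing assumption: the Riccati equations for $P$ and $P^x$ have unique solutions on $[0,T]$. Partition $P_t=(P_t^{ab})_{a=1,2,3;\,b=1,2}$, $\mathcal G_t=(\mathcal G_t^a)_{a=1,2,3}$ with row block sizes $d_0,d,d$ and column block sizes $d_0,d$. **Propagators.** With $A_t^{22}:=A+F-MP_t^{32}$, $A_t^{44}:=A+F-MP_t^x$,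 $$\mathbb A_t^0=\begin{pmatrix}A_0-M_0P_t^{11}&-M_0P_t^{12}&0&F_0\\ G-MP_t^{31}&A_t^{22}&0&0\\ G-MP_t^{31}&0&A_t^{22}&0\\ G-MP_t^{31}&0&-M(P_t^{32}-P_t^x)&A_t^{44}\end{pmatrix},$$ $\Phi_t=(\Phi_t^{ab})_{1\le a,b\le4}$ (block sizes $d_0,d,d,d$) solves $\dot\Phi_t=\mathbb A_t^0\Phi_t$, $\Phi_0=I_{3d+d_0}$; $\Phi_t^x$ solves $\dot\Phi_t^x=A_t^{22}\Phi_t^x$, $\Phi_0^x=I_d$; $\mathcal M_t^0=\int_0^t(\Phi_s^x)^{-1}(G-MP_s^{31})\Phi_s^{12}ds$, $\bar{\mathcal M}_t=\int_0^t(\Phi_s^x)^{-1}(G-MP_s^{31})\Phi_s^{13}ds$. **Observed process for an observation set.** Given $\mathcal I_{obs}=\{j_1,\dots,j_q\}$, the major agent observes $\mathcal X_t^0=((X_t^0)^\top,(X_t^{j_1})^\top,\dots,(X_t^{j_q})^\top,(z_t^0)^\top)^\top$ (major state, observed minor states, mean field state internally updated by the major agent). The unknown constant initial-information errors are $\mathcal E^0=((e^0)^\top,(\mathcal E^{obs})^\top,\bar e^\top)^\top$, $\mathcal E^{obs}=((e^{j_1})^\top,\dots,(e^{j_q})^\top)^\top$; with independent Brownian motions collected in $\mathbb W_t^0=((W_t^0)^\top,(W_t^{j_1})^\top,\dots,(W_t^{j_q})^\top)^\top$, $$d\mathcal X_t^0=(\mathbb A_t^2\mathcal X_t^0+\beta_t^0)dt-\mathbb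 K_t^0\mathcal E^0dt+\mathbb D^0d\mathbb W_t^0.$$ With $I^q=(I_d,\dots,I_d)^\top\in\mathbb R^{qd\times d}$, $$\mathbb A_t^2=\begin{pmatrix}A_0-M_0P_t^{11}&0&F_0-M_0P_t^{12}\\ I^q(G-MP_t^{31})&\mathrm{diag}(a_t^1,\dots,a_t^1)&I^q(F-M(P_t^{32}-P_t^x))\\ G-MP_t^{31}&0&A_t^{22}\end{pmatrix},\ \beta_t^0=\begin{pmatrix}-M_0\mathcal G_t^1\\ -I^qM\mathcal G_t^3\\ -M\mathcal G_t^3\end{pmatrix},$$ $$\mathbb D^0=\begin{pmatrix}D_0&0\\ 0&\mathrm{diag}(D,\dots,D)\\ 0&0\end{pmatrix},\ \mathbb K_t^0=\begin{pmatrix}F_0(\Phi_t^{22}-\Phi_t^{42})&0&F_0(\Phi_t^{23}-\Phi_t^{43})\\ I^q\mathcal K_t^1&\mathrm{diag}(k_t^1,\dots,k_t^1)&I^q\bar{\mathcal K}_t^1\\ 0&0&0\end{pmatrix},$$ (one diagonal block per observed minor agent), $a_t^1=A-MP_t^x$, $k_t^1=M(P_t^{32}-P_t^x)\Phi_t^x$, $$\mathcal K_t^1=(F-M(P_t^{32}-P_t^x))\Phi_t^{22}-F\Phi_t^{42}+M(P_t^{32}-P_t^x)\Phi_t^x\mathcal M_t^0,$$ $$\bar{\mathcal K}_t^1=(F-M(P_t^{32}-P_t^x))\Phi_t^{23}-F\Phi_t^{43}+M(P_t^{32}-P_t^x)\Phi_t^x\bar{\mathcal M}_t.$$ $\Psi_t$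 solves $\dot\Psi_t=\mathbb A_t^2\Psi_t$, $\Psi_0=I_{(q+1)d+d_0}$. **Information matrices.** For $0\le s\le k-1$, $$H_s^0=\Psi_{t_{s+1}}\int_{t_s}^{t_{s+1}}\Psi_u^{-1}\mathbb K_u^0du,\quad \Sigma_s^0=\Psi_{t_{s+1}}\int_{t_s}^{t_{s+1}}\Psi_u^{-1}\mathbb D^0(\mathbb D^0)^\top\Psi_u^{-\top}du\,\Psi_{t_{s+1}}^\top,$$ $$\mathcal I_0^{(k)}(\tau)=\sum_{s=0}^{k-1}(H_s^0)^\top(\Sigma_s^0)^{-1}H_s^0,\quad S_\theta=\begin{pmatrix}I_d&0&0\\ 0&0&I_d\end{pmatrix},\quad S_\eta=\begin{pmatrix}0&I_{qd}&0\end{pmatrix}$$ (column block sizes $d,qd,d$), $\mathcal I_{\theta\theta}^{(k)}=S_\theta\mathcal I_0^{(k)}(\tau)S_\theta^\top$, $\mathcal I_{\eta\eta}^{(k)}=S_\eta\mathcal I_0^{(k)}(\tau)S_\eta^\top$, $\mathcal I_{\theta\eta}^{(k)}=S_\theta\mathcal I_0^{(k)}(\tau)S_\eta^\top$, $\mathcal I_{\eta\theta}^{(k)}=(\mathcal I_{\theta\eta}^{(k)})^\top$, and the effective information matrix is $$\mathcal I_{0,\mathrm{eff}}^{(k)}(\tau)=\mathcal I_{\theta\theta}^{(k)}-\mathcal I_{\theta\eta}^{(k)}\big(\mathcal I_{\eta\eta}^{(k)}\big)^{-1}\mathcal I_{\eta\theta}^{(k)}.$$ $\succ0$ means positive definite.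 *)

(* Defs.v *)
From HB Require Import structures.
From mathcomp Require Export all_boot all_order all_algebra.
From mathcomp Require Export all_classical all_reals all_analysis.
Import Order.TTheory GRing.Theory Num.Theory numFieldNormedType.Exports.

Set Implicit Arguments.
Unset Strict Implicit.
Unset Printing Implicit Defensive.

Local Open Scope classical_set_scope.
Local Open Scope ring_scope.

Section MatrixCalculus.
Variable R : realType.

Definition psd_mx n (S : 'M[R]_n) : Prop :=
  S^T = S /\ forall x : 'cV[R]_n, 0 <= (x^T *m S *m x) ord0 ord0.

Definition pd_mx n (S : 'M[R]_n) : Prop :=
  S^T = S /\ forall x : 'cV[R]_n, x != 0 -> 0 < (x^T *m S *m x) ord0 ord0.

(* The difference quotients are taken along points of [0, T] only, so the
   derivative is one-sided at 0 and at T. *)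
Definition derivative_on (T : R) n1 n2 (X dX : R -> 'M[R]_(n1, n2)) : Prop :=
  forall t : R, t \in `[0, T] -> forall i j,
    (fun s => (X s i j - X t i j) / (s - t)) @ within `[0, T] t^' --> dX t i j.

Definition integral_mx (a b : R) n1 n2 (X : R -> 'M[R]_(n1, n2)) :
    'M[R]_(n1, n2) :=
  \matrix_(i, j) \int[lebesgue_measure]_(u in `[a, b]) X u i j.

End MatrixCalculus.

Record lq_params (R : realType) (d d0 m m0 : nat) := LQParams {
  T_ : R;
  A_ : 'M[R]_d; F_ : 'M[R]_d; D_ : 'M[R]_d;
  G_ : 'M[R]_(d, d0); B_ : 'M[R]_(d, m);
  A0_ : 'M[R]_d0; D0_ : 'M[R]_d0;
  F0_ : 'M[R]_(d0, d); B0_ : 'M[R]_(d0, m0);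
  Q_ : 'M[R]_d; Qbar_ : 'M[R]_d;
  Q0_ : 'M[R]_d0; Q0bar_ : 'M[R]_d0;
  R_ : 'M[R]_m; R0_ : 'M[R]_m0;
  Gam_ : 'M[R]_d; Gambar_ : 'M[R]_d;
  Lam_ : 'M[R]_(d, d0); Lambar_ : 'M[R]_(d, d0);
  Gam0_ : 'M[R]_(d0, d); Gam0bar_ : 'M[R]_(d0, d);
  eta_ : 'cV[R]_d; etabar_ : 'cV[R]_d;
  eta0_ : 'cV[R]_d0; eta0bar_ : 'cV[R]_d0 }.

(* The time functions of the model that do not depend on the observation set.
   The row blocks of P and Gcal have sizes d0, d, d; the blocks of Phi have
   sizes d0, d, d, d. *)
Record lq_functions (R : realType) (d d0 : nat) := LQFunctions {
  P_ : R -> 'M[R]_(d0 + d + d, d0 + d);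
  Gcal_ : R -> 'cV[R]_(d0 + d + d);
  Px_ : R -> 'M[R]_d;
  Phi_ : R -> 'M[R]_(d0 + (d + (d + d)));
  Phix_ : R -> 'M[R]_d }.

Section Model.
Variables (R : realType) (d d0 m m0 : nat).
Variables (pr : lq_params R d d0 m m0) (fn : lq_functions R d d0).

Local Notation T := (T_ pr).
Local Notation A := (A_ pr).
Local Notation F := (F_ pr).
Local Notation D := (D_ pr).
Local Notation G := (G_ pr).
Local Notation B := (B_ pr).
Local Notation A0 := (A0_ pr).
Local Notation D0 := (D0_ pr).
Local Notation F0 := (F0_ pr).
Local Notation B0 := (B0_ pr).
Local Notation Q := (Q_ pr).
Local Notation Qbar := (Qbar_ pr).
Local Notation Q0 := (Q0_ pr).
Local Notation Q0bar := (Q0bar_ pr).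
Local Notation Gam := (Gam_ pr).
Local Notation Gambar := (Gambar_ pr).
Local Notation Lam := (Lam_ pr).
Local Notation Lambar := (Lambar_ pr).
Local Notation Gam0 := (Gam0_ pr).
Local Notation Gam0bar := (Gam0bar_ pr).
Local Notation P := (P_ fn).
Local Notation Gcal := (Gcal_ fn).
Local Notation Px := (Px_ fn).
Local Notation Phi := (Phi_ fn).
Local Notation Phix := (Phix_ fn).

Definition admissible_params : Prop :=
  [/\ 0 < T,
      psd_mx Q /\ psd_mx Qbar,
      psd_mx Q0 /\ psd_mx Q0bar,
      pd_mx (R_ pr) & pd_mx (R0_ pr)].

Definition M_ : 'M[R]_d := B *m invmx (R_ pr) *m B^T.
Definition M0_ : 'M[R]_d0 := B0 *m invmx (R0_ pr) *m B0^T.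
Local Notation M := M_.
Local Notation M0 := M0_.

Definition Pi0 : 'M[R]_(d0, d0 + d) := row_mx 1%:M (- Gam0).
Definition Pi0bar : 'M[R]_(d0, d0 + d) := row_mx 1%:M (- Gam0bar).

Definition A1 : 'M[R]_(d0 + d) := block_mx A0 F0 G (A + F).
Definition bbA : 'M[R]_(d0 + d + d) := block_mx A1 0 0 A.
Definition bbM : 'M[R]_(d0 + d, d0 + d + d) :=
  row_mx (block_mx M0 0 0 0) (col_mx 0 M).

Definition calQ_of (q0 : 'M[R]_d0) (g0 : 'M[R]_(d0, d)) (q : 'M[R]_d)
    (l : 'M[R]_(d, d0)) (g : 'M[R]_d) : 'M[R]_(d0 + d + d, d0 + d) :=
  col_mx (block_mx q0 (- (q0 *m g0)) (- (g0^T *m q0)) (g0^T *m q0 *m g0))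
         (row_mx (- (q *m l)) (- (q *m (g - 1%:M)))).
Definition calQ := calQ_of Q0 Gam0 Q Lam Gam.
Definition calQbar := calQ_of Q0bar Gam0bar Qbar Lambar Gambar.

Definition nu : 'cV[R]_(d0 + d + d) :=
  col_mx (Pi0^T *m Q0 *m eta0_ pr) (Q *m eta_ pr).
Definition nubar : 'cV[R]_(d0 + d + d) :=
  col_mx (Pi0bar^T *m Q0bar *m eta0bar_ pr) (Qbar *m etabar_ pr).

(* The equations read - dX/dt = ..., hence the leading minus sign. *)
Definition riccati_P (X : R -> 'M[R]_(d0 + d + d, d0 + d)) : Prop :=
  derivative_on T X (fun t =>
    - (bbA^T *m X t + X t *m A1 - X t *m bbM *m X t + calQ))
  /\ X T = calQbar.

Definition riccati_Px (X : R -> 'M[R]_d) : Prop :=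
  derivative_on T X (fun t =>
    - (A^T *m X t + X t *m A - X t *m M *m X t + Q))
  /\ X T = Qbar.

Definition equation_Gcal : Prop :=
  derivative_on T Gcal (fun t => - ((bbA^T - P t *m bbM) *m Gcal t - nu))
  /\ Gcal T = - nubar.

Definition P11 t : 'M[R]_d0 := ulsubmx (usubmx (P t)).
Definition P12 t : 'M[R]_(d0, d) := ursubmx (usubmx (P t)).
Definition P31 t : 'M[R]_(d, d0) := lsubmx (dsubmx (P t)).
Definition P32 t : 'M[R]_d := rsubmx (dsubmx (P t)).

Definition A22 t : 'M[R]_d := A + F - M *m P32 t.
Definition A44 t : 'M[R]_d := A + F - M *m Px t.
Definition GP31 t : 'M[R]_(d, d0) := G - M *m P31 t.
Definition MPP t : 'M[R]_d := M *m (P32 t - Px t).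

Definition bbA0 t : 'M[R]_(d0 + (d + (d + d))) :=
  block_mx (A0 - M0 *m P11 t) (row_mx (- (M0 *m P12 t)) (row_mx 0 F0))
    (col_mx (GP31 t) (col_mx (GP31 t) (GP31 t)))
    (block_mx (A22 t) 0 0 (block_mx (A22 t) 0 (- MPP t) (A44 t))).

Definition equation_Phi : Prop :=
  derivative_on T Phi (fun t => bbA0 t *m Phi t) /\ Phi 0 = 1%:M.

Definition equation_Phix : Prop :=
  derivative_on T Phix (fun t => A22 t *m Phix t) /\ Phix 0 = 1%:M.

Definition model_functions : Prop :=
  [/\ riccati_P P /\ (forall X, riccati_P X -> {in `[0, T], X =1 P}),
      riccati_Px Px /\ (forall X, riccati_Px X -> {in `[0, T], X =1 Px}),
      equation_Gcal, equation_Phi & equation_Phix].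

Definition Phi12 t : 'M[R]_(d0, d) := lsubmx (ursubmx (Phi t)).
Definition Phi13 t : 'M[R]_(d0, d) := lsubmx (rsubmx (ursubmx (Phi t))).
Definition Phi22 t : 'M[R]_d := ulsubmx (drsubmx (Phi t)).
Definition Phi23 t : 'M[R]_d := lsubmx (ursubmx (drsubmx (Phi t))).
Definition Phi42 t : 'M[R]_d := dsubmx (dlsubmx (drsubmx (Phi t))).
Definition Phi43 t : 'M[R]_d := dlsubmx (drsubmx (drsubmx (Phi t))).

Definition calM0 t : 'M[R]_d :=
  integral_mx 0 t (fun s => invmx (Phix s) *m GP31 s *m Phi12 s).
Definition calMbar t : 'M[R]_d :=
  integral_mx 0 t (fun s => invmx (Phix s) *m GP31 s *m Phi13 s).

Definition a1 t : 'M[R]_d := A - M *m Px t.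
Definition k1 t : 'M[R]_d := MPP t *m Phix t.
Definition calK1 t : 'M[R]_d :=
  (F - MPP t) *m Phi22 t - F *m Phi42 t + MPP t *m Phix t *m calM0 t.
Definition calK1bar t : 'M[R]_d :=
  (F - MPP t) *m Phi23 t - F *m Phi43 t + MPP t *m Phix t *m calMbar t.

Section ObservationSet.
Variables (N : nat) (Iobs : {set 'I_N}).

(* The observed minor agents are stacked in the order of enum Iobs, one block
   of size d for each; obs_size is thus q * d for q = #|Iobs|.  The state
   (X^0, X^{j_1}, ..., X^{j_q}, z^0), the initial error (e^0, e^{j_1}, ...,
   e^{j_q}, ebar) and the noise (W^0, W^{j_1}, ..., W^{j_q}) follow
     dX = (bbA2 X + beta0) dt - bbK0 E dt + bbD0 dW.
   The information matrices do not involve the drift offset beta0, the only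
   place where Gcal enters. *)
Definition obs_size : nat := (\sum_(i < #|Iobs|) d)%N.
Definition state_size : nat := (d0 + (obs_size + d))%N.
Definition error_size : nat := (d + (obs_size + d))%N.
Definition noise_size : nat := (d0 + obs_size)%N.

Definition Iq : 'M[R]_(obs_size, d) := \mxcol_(i < #|Iobs|) 1%:M.
Definition diag_obs (X : 'M[R]_d) : 'M[R]_obs_size :=
  \mxdiag_(i < #|Iobs|) X.

Definition bbA2 t : 'M[R]_state_size :=
  block_mx (A0 - M0 *m P11 t) (row_mx 0 (F0 - M0 *m P12 t))
    (col_mx (Iq *m GP31 t) (GP31 t))
    (block_mx (diag_obs (a1 t)) (Iq *m (F - MPP t)) 0 (A22 t)).

Definition bbD0 : 'M[R]_(state_size, noise_size) :=
  block_mx D0 0 0 (col_mx (diag_obs D) 0).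

Definition bbK0 t : 'M[R]_(state_size, error_size) :=
  block_mx (F0 *m (Phi22 t - Phi42 t))
    (row_mx 0 (F0 *m (Phi23 t - Phi43 t)))
    (col_mx (Iq *m calK1 t) 0)
    (block_mx (diag_obs (k1 t)) (Iq *m calK1bar t) 0 0).

Variable Psi : R -> 'M[R]_state_size.

Definition equation_Psi : Prop :=
  derivative_on T Psi (fun t => bbA2 t *m Psi t) /\ Psi 0 = 1%:M.

Variables (k : nat) (t : nat -> R).

Definition H0 s : 'M[R]_(state_size, error_size) :=
  Psi (t s.+1) *m
  integral_mx (t s) (t s.+1) (fun u => invmx (Psi u) *m bbK0 u).

Definition Sigma0 s : 'M[R]_state_size :=
  Psi (t s.+1) *m
  integral_mx (t s) (t s.+1)
    (fun u => invmx (Psi u) *m bbD0 *m bbD0^T *m (invmx (Psi u))^T) *m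
  (Psi (t s.+1))^T.

Definition information : 'M[R]_error_size :=
  \sum_(s < k) (H0 s)^T *m invmx (Sigma0 s) *m H0 s.

Definition S_theta : 'M[R]_(d + d, error_size) :=
  block_mx 1%:M 0 0 (row_mx 0 1%:M).
Definition S_eta : 'M[R]_(obs_size, error_size) :=
  row_mx 0 (row_mx 1%:M 0).

Definition info_theta_theta := S_theta *m information *m S_theta^T.
Definition info_eta_eta := S_eta *m information *m S_eta^T.
Definition info_theta_eta := S_theta *m information *m S_eta^T.
Definition info_eta_theta := info_theta_eta^T.

Definition effective_information : 'M[R]_(d + d) :=
  info_theta_theta - info_theta_eta *m invmx info_eta_eta *m info_eta_theta.

Definition nondegenerate_information : Prop :=
  [/\ forall s, (s < k)%N -> pd_mx (Sigma0 s),
      pd_mx info_eta_eta & pd_mx effective_information].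

End ObservationSet.
End Model.

(* Main.v *)
(** The agents share all parameters, so the observation set enters [bbA2],
    [bbK0] and [bbD0] only through its cardinality [q]: for two sets of the same
    size, [Psi] and [Psi'] solve one and the same linear equation with the same
    initial value.  Its coefficient is bounded on [0, T], because [P] and [Px]
    are differentiable there, hence the two solutions agree on [0, T]: the
    squared norm [E] of their difference satisfies [E' <= C E] and [E 0 = 0], so
    [exp (- C t) * E t] is nonincreasing and vanishes.  Outside [0, T] they may
    differ, but the information matrices only see [0, tau]. *)

From mathcomp Require Import ring lra.
Require Import Defs.
Import Order.TTheory GRing.Theory Num.Theory numFieldNormedType.Exports.
Local Open Scope classical_set_scope.
Local Open Scope ring_scope.

Set Implicit Arguments.
Unset Strict Implicit.

(** * Difference quotients relative to a set: continuity, derivatives and bounds *)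

(** For [s != t], [f s] is the quotient times [s - t], plus [f t]; the product tends to
    [df t * 0]. *)
Lemma quotient_within_continuous {R : realType} (A : set R) (f df : R -> R) :
  (forall t : R, A t ->
    (fun s : R => (f s - f t) / (s - t)) @ within A t^' --> df t) ->
  {within A, continuous f}.
Proof.
move=> fdf.
have f_t (t : R) : A t -> f @ within A t^' --> f t.
  move=> At.
  have id_t : (fun s : R => s - t) @ within A t^' --> (0 : R).
    rewrite -(subrr t); apply: cvgB; last exact: cvg_cst.
    by apply: cvg_within_filter => U tU; exact: nbhs_dnbhs.
  have : (fun s : R => (f s - f t) / (s - t) * (s - t) + f t) @ within A t^'
      --> df t * 0 + f t.
    by apply: cvgD; [apply: cvgM => //; exact: fdf|exact: cvg_cst].
  rewrite mulr0 add0r; apply: cvg_trans; apply: near_eq_cvg.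
  near=> s; rewrite divfK ?subrK// subr_eq0.
  by near: s; apply: cvg_within; exact: withinT.
apply/subspace_continuousP => t At U fU.
have := f_t t At U fU; rewrite /= !nbhs_simpl /within /= => tU.
apply: (@filterS _ (nbhs t) _ _ _ _ tU) => s /= sU As.
(* The punctured limit says nothing at [s = t], where the value is [f t] itself. *)
have [->|st] := eqVneq s t; first exact: nbhs_singleton.
exact: sU.
Unshelve. all: by end_near.
Qed.

Lemma quotient_is_derive {R : realType} (A : set R) (f : R -> R) (t l : R) :
  A° t -> (fun s : R => (f s - f t) / (s - t)) @ within A t^' --> l ->
  is_derive t 1 f l.
Proof.
move=> At fl.
have {}fl : (fun h => h^-1 *: ((f \o shift t) (h *: 1) - f t)) @ 0^' --> l.
  move=> U lU; have := fl U lU; rewrite /= !nbhs_simpl /within /= => tU.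
  have {}tU : \forall s \near t, s != t -> U ((f s - f t) / (s - t)).
    by apply: filterS2 At tU => s As tU st; exact: tU.
  have : (fun h : R => h + t) @ 0 --> t.
    by rewrite -[X in _ --> X]add0r; apply: cvgD; [exact: cvg_id|exact: cvg_cst].
  move=> /(_ _ tU); rewrite /= !nbhs_simpl /= => hU.
  apply: (@filterS _ (nbhs (0 : R)) _ _ _ _ hU) => h /= Uh h0.
  have := Uh _; rewrite addrK mulrC -[_ *: 1]/(h * 1) mulr1; apply.
  by rewrite -subr_eq0 addrK.
by apply: DeriveDef; [exact: (cvgP l)|exact: cvg_lim fl].
Qed.

Lemma within_continuous_bounded {R : realType} (A : set R) (f : R -> R) :
  compact A -> {within A, continuous f} ->
  exists C, forall t, A t -> `|f t| <= C.
Proof.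
move=> cA fc.
have /compact_bounded[C [_ fC]] := continuous_compact fc cA.
(* Boundedness provides every real strictly above [C] as a bound, hence [C + 1]. *)
by exists (C + 1) => t At; apply: (fC (C + 1)); [rewrite ltrDl|exists t].
Qed.

(** * Uniqueness for linear matrix differential equations *)

Lemma derivative_onB {R : realType} (T : R) n p (X dX Y dY : R -> 'M[R]_(n, p)) :
  derivative_on T X dX -> derivative_on T Y dY ->
  derivative_on T (fun t => X t - Y t) (fun t => dX t - dY t).
Proof.
move=> XdX YdY t t0T i j.
have -> : (dX t - dY t) i j = dX t i j - dY t i j by rewrite !mxE.
suff : (fun s : R => ((X s - Y s) i j - (X t - Y t) i j) / (s - t))
    @ within `[0, T] (t : R)^' --> dX t i j - dY t i j by [].
have -> : (fun s : R => ((X s - Y s) i j - (X t - Y t) i j) / (s - t)) =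
    (fun s => (X s i j - X t i j) / (s - t) - (Y s i j - Y t i j) / (s - t)).
  by apply/funext => s; rewrite !mxE; ring.
by apply: cvgB; [exact: XdX|exact: YdY].
Qed.

(** When [|a| <= L], [2 a y z <= L (y^2 + z^2)]. Summed over [i], [j], [l], each squared entry of
    [Y] occurs [n] times as [y] and [n] times as [z], which gives the factor [2 n L]. *)
Lemma energy_bound {R : realType} n p (L : R) (A : 'M[R]_n) (Y : 'M[R]_(n, p)) :
  (forall i l, `|A i l| <= L) ->
  \sum_i \sum_j 2 * Y i j * (A *m Y) i j <=
  L * n%:R * 2 * \sum_i \sum_j Y i j ^+ 2.
Proof.
move=> AL.
pose S := \sum_i \sum_j Y i j ^+ 2; rewrite -/S.
have -> : L * n%:R * 2 * S = \sum_i \sum_j \sum_l L * (Y i j ^+ 2 + Y l j ^+ 2).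
  transitivity (\sum_(i < n) (L * n%:R * (\sum_j Y i j ^+ 2) + L * S)).
    rewrite big_split /= -mulr_sumr -/S sumr_const card_ord -mulr_natl; ring.
  apply: eq_bigr => i _; rewrite /S exchange_big /= mulr_sumr.
  rewrite [X in _ + X]mulr_sumr -big_split /=.
  apply: eq_bigr => j _; rewrite -mulr_sumr big_split /= sumr_const card_ord.
  by rewrite -mulr_natl; ring.
apply: ler_sum => i _; apply: ler_sum => j _.
rewrite mxE mulr_sumr; apply: ler_sum => l _.
have := AL i l; rewrite ler_norml => /andP[NLA AL'].
have LA : 0 <= L - A i l by rewrite subr_ge0.
have LNA : 0 <= L + A i l by rewrite -lerBlDl sub0r.
(* [L (y^2 + z^2) - 2 a y z] is half of the sum of the two products below. *)
have := mulr_ge0 LA (sqr_ge0 (Y i j + Y l j)).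
have := mulr_ge0 LNA (sqr_ge0 (Y i j - Y l j)).
lra.
Qed.

Lemma linear_ode_eq0 {R : realType} (T : R) n p (A : R -> 'M[R]_n)
    (Y : R -> 'M[R]_(n, p)) (L : R) :
  (forall t, t \in `[0, T] -> forall i l, `|A t i l| <= L) ->
  derivative_on T Y (fun t => A t *m Y t) -> Y 0 = 0 ->
  {in `[0, T], forall t, Y t = 0}.
Proof.
move=> AL YdY Y0 t t0T.
pose E s := \sum_i \sum_j Y s i j ^+ 2.
(* The constant of [energy_bound], so that [E' <= C E]; the exponential in [g] is the matching
   integrating factor. *)
pose C := L * n%:R * 2.
pose g s := expR (- C * s) * E s.
have dg s : s \in `]0, T[ -> is_derive s 1 g
    (expR (- C * s) *
      (\sum_i \sum_j 2 * Y s i j * (A s *m Y s) i j - C * E s)).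
  move=> s0T.
  have dY i j : is_derive s 1 (fun u => Y u i j) ((A s *m Y s) i j).
    apply: (@quotient_is_derive _ `[0, T]).
      by rewrite interior_itv_bnd.
    by apply: YdY; exact: subset_itv_oo_cc.
  have dE : is_derive s 1 E (\sum_i \sum_j 2 * Y s i j * (A s *m Y s) i j).
    have -> : E = \sum_i \sum_j (fun u => Y u i j) ^+ 2.
      apply/funext => u; rewrite fct_sumE; apply: eq_bigr => i _.
      by rewrite fct_sumE; apply: eq_bigr => j _; rewrite exprfctE.
    exact: is_derive_sum.
  apply: is_derive_eq; rewrite /GRing.scale /=; ring.
(* The derivative of [g] is two-sided only inside the interval; continuity extends the monotonicity
   to the endpoints, in particular to 0, where [g] vanishes. *)
have gc : {within `[0, T], continuous g}.
  have idc : {within `[0, T], continuous (fun s : R => expR (- C * s))}.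
    apply: continuous_subspaceT => s; apply: continuous_comp.
      by apply: cvgM; [exact: cvg_cst|exact: cvg_id].
    exact: continuous_expR.
  move=> s; apply: cvgM; first exact: idc.
  apply: cvg_big => [|i _]; first exact: add_continuous.
  apply: cvg_big => [|j _]; first exact: add_continuous.
  have Yc := @quotient_within_continuous _ `[0, T] (fun u => Y u i j) _
    (fun u u0T => YdY u u0T i j).
  by apply: cvgM; exact: Yc.
have Ege0 s : 0 <= E s.
  by apply: sumr_ge0 => i _; apply: sumr_ge0 => j _; exact: sqr_ge0.
have [t_ge0 t_leT] : 0 <= t /\ t <= T by move: t0T; rewrite in_itv /= => /andP.
have g_le0 : g t <= 0.
  have <- : g 0 = 0.
    rewrite /g /E Y0 big1 ?mulr0// => i _; rewrite big1 // => j _.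
    by rewrite mxE expr0n.
  apply: (@ler0_derive1_le_cc _ g 0 T).
  - by move=> s /dg [].
  - move=> s s0T; rewrite derive1E (@derive_val _ _ _ _ _ _ _ (dg s s0T)).
    rewrite pmulr_rle0 ?expR_gt0// subr_le0; apply: energy_bound; apply: AL.
    exact: subset_itv_oo_cc.
  - exact: gc.
  - exact: t0T.
  - by rewrite in_itv /= lexx (le_trans t_ge0).
  - exact: t_ge0.
have Et : E t = 0.
  by apply/le_anti; rewrite Ege0 andbT -(pmulr_rle0 _ (expR_gt0 (- C * t))).
apply/matrixP => i j; rewrite mxE; apply/eqP; rewrite -sqrf_eq0; apply/eqP.
move: Et => /psumr_eq0P /(_ i isT) Ei.
have /psumr_eq0P : \sum_j Y t i j ^+ 2 = 0.
  by apply: Ei => k _; apply: sumr_ge0 => l _; exact: sqr_ge0.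
by apply => // k _; exact: sqr_ge0.
Qed.

(** * Bounded matrix functions on [0, T] *)

(** The bound may depend on the entry, which suits entrywise closure proofs; [bounded_mx_on_uniform]
    then yields the single constant that [linear_ode_eq0] takes. *)
Definition bounded_mx_on {R : realType} (T : R) n p (X : R -> 'M[R]_(n, p)) : Prop :=
  forall i j, exists C, forall t, t \in `[0, T] -> `|X t i j| <= C.

Lemma bounded_mx_on_uniform {R : realType} (T : R) n p (X : R -> 'M[R]_(n, p)) :
  bounded_mx_on T X ->
  exists C, forall t, t \in `[0, T] -> forall i j, `|X t i j| <= C.
Proof.
move=> bX; have [C XC] := choice (fun ij => bX ij.1 ij.2).
(* A sum of nonnegative terms dominates each of the entrywise bounds. *)
exists (\sum_ij `|C ij|) => t t0T i j.
rewrite (bigD1 (i, j)) //= (le_trans (XC (i, j) t t0T))//.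
by rewrite (le_trans (ler_norm _))// lerDl sumr_ge0.
Qed.

(** Differentiability gives continuity relative to the compact segment. Applied to the Riccati
    solutions [P] and [Px]. *)
Lemma bounded_mx_on_derivative {R : realType} (T : R) n p
    (X dX : R -> 'M[R]_(n, p)) :
  derivative_on T X dX -> bounded_mx_on T X.
Proof.
move=> XdX i j; apply: (@within_continuous_bounded _ `[0, T] (fun u => X u i j)).
  exact: segment_compact.
exact: (quotient_within_continuous (fun t t0T => XdX t t0T i j)).
Qed.

Section BoundedMatrices.
Context {R : realType} (T : R).
Local Notation bounded := (bounded_mx_on T).

Lemma bounded_mx_on_cst n p (X : 'M[R]_(n, p)) : bounded (fun=> X).
Proof. by move=> i j; exists `|X i j|. Qed.

Lemma bounded_mx_onD n p (X Y : R -> 'M[R]_(n, p)) :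
  bounded X -> bounded Y -> bounded (fun t => X t + Y t).
Proof.
move=> bX bY i j; have [C XC] := bX i j; have [D YD] := bY i j.
exists (C + D) => t t0T; rewrite mxE (le_trans (ler_normD _ _))//.
by rewrite lerD ?XC ?YD.
Qed.

Lemma bounded_mx_onN n p (X : R -> 'M[R]_(n, p)) :
  bounded X -> bounded (fun t => - X t).
Proof.
move=> bX i j; have [C XC] := bX i j.
by exists C => t t0T; rewrite mxE normrN XC.
Qed.

Lemma bounded_mx_onM n p q (X : R -> 'M[R]_(n, p)) (Y : R -> 'M[R]_(p, q)) :
  bounded X -> bounded Y -> bounded (fun t => X t *m Y t).
Proof.
move=> bX bY i j.
have [C XC] := choice (bX i); have [D YD] := choice (bY ^~ j).
exists (\sum_k C k * D k) => t t0T; rewrite mxE (le_trans (ler_norm_sum _ _ _))//.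
by apply: ler_sum => k _; rewrite normrM ler_pM ?XC ?YD.
Qed.

Lemma bounded_mx_on_usub n1 n2 p (X : R -> 'M[R]_(n1 + n2, p)) :
  bounded X -> bounded (fun t => usubmx (X t)).
Proof.
move=> bX i j; have [C XC] := bX (lshift n2 i) j.
by exists C => t t0T; rewrite mxE XC.
Qed.

Lemma bounded_mx_on_dsub n1 n2 p (X : R -> 'M[R]_(n1 + n2, p)) :
  bounded X -> bounded (fun t => dsubmx (X t)).
Proof.
move=> bX i j; have [C XC] := bX (rshift n1 i) j.
by exists C => t t0T; rewrite mxE XC.
Qed.

Lemma bounded_mx_on_lsub n p1 p2 (X : R -> 'M[R]_(n, p1 + p2)) :
  bounded X -> bounded (fun t => lsubmx (X t)).
Proof.
move=> bX i j; have [C XC] := bX i (lshift p2 j).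
by exists C => t t0T; rewrite mxE XC.
Qed.

Lemma bounded_mx_on_rsub n p1 p2 (X : R -> 'M[R]_(n, p1 + p2)) :
  bounded X -> bounded (fun t => rsubmx (X t)).
Proof.
move=> bX i j; have [C XC] := bX i (rshift p1 j).
by exists C => t t0T; rewrite mxE XC.
Qed.

Lemma bounded_mx_on_col n1 n2 p (X : R -> 'M[R]_(n1, p)) (Y : R -> 'M[R]_(n2, p)) :
  bounded X -> bounded Y -> bounded (fun t => col_mx (X t) (Y t)).
Proof.
move=> bX bY i j; have [i' ->|i' ->] := split_ordP i.
  by have [C XC] := bX i' j; exists C => t t0T; rewrite col_mxEu XC.
by have [C YC] := bY i' j; exists C => t t0T; rewrite col_mxEd YC.
Qed.

Lemma bounded_mx_on_row n p1 p2 (X : R -> 'M[R]_(n, p1)) (Y : R -> 'M[R]_(n, p2)) :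
  bounded X -> bounded Y -> bounded (fun t => row_mx (X t) (Y t)).
Proof.
move=> bX bY i j; have [j' ->|j' ->] := split_ordP j.
  by have [C XC] := bX i j'; exists C => t t0T; rewrite row_mxEl XC.
by have [C YC] := bY i j'; exists C => t t0T; rewrite row_mxEr YC.
Qed.

Lemma bounded_mx_on_block n1 n2 p1 p2 (X : R -> 'M[R]_(n1, p1))
    (Y : R -> 'M[R]_(n1, p2)) (Z : R -> 'M[R]_(n2, p1)) (W : R -> 'M[R]_(n2, p2)) :
  bounded X -> bounded Y -> bounded Z -> bounded W ->
  bounded (fun t => block_mx (X t) (Y t) (Z t) (W t)).
Proof.
move=> bX bY bZ bW.
by apply: bounded_mx_on_col; apply: bounded_mx_on_row.
Qed.

Lemma bounded_mx_on_mxdiag n d (X : R -> 'M[R]_d) :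
  bounded X -> bounded (fun t => \mxdiag_(i < n) X t).
Proof.
move=> bX i j; have [C XC] := bX (tagnat.sig2 i) (tagnat.sig2 j).
(* Entries outside the diagonal blocks are 0, so a visibly nonnegative bound covers both cases. *)
exists `|C| => t t0T; rewrite /mxdiag mxE; case: eqP => _.
  by rewrite conform_mx_id (le_trans (XC t t0T))// ler_norm.
by rewrite mxE normr0.
Qed.

End BoundedMatrices.

(** * Uniqueness of [Psi] for a fixed observation set *)

Lemma bounded_bbA2 {R : realType} d d0 m m0 (pr : lq_params R d d0 m m0)
    (fn : lq_functions R d d0) N (Iobs : {set 'I_N}) :
  bounded_mx_on (T_ pr) (P_ fn) -> bounded_mx_on (T_ pr) (Px_ fn) ->
  bounded_mx_on (T_ pr) (bbA2 pr fn Iobs).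
Proof.
move=> bP bPx.
have bP11 : bounded_mx_on (T_ pr) (P11 fn).
  exact/bounded_mx_on_lsub/bounded_mx_on_usub/bounded_mx_on_usub.
have bP12 : bounded_mx_on (T_ pr) (P12 fn).
  exact/bounded_mx_on_rsub/bounded_mx_on_usub/bounded_mx_on_usub.
have bP31 : bounded_mx_on (T_ pr) (P31 fn).
  exact/bounded_mx_on_lsub/bounded_mx_on_dsub.
have bP32 : bounded_mx_on (T_ pr) (P32 fn).
  exact/bounded_mx_on_rsub/bounded_mx_on_dsub.
have bGP31 : bounded_mx_on (T_ pr) (GP31 pr fn).
  apply: bounded_mx_onD; first exact: bounded_mx_on_cst.
  exact/bounded_mx_onN/bounded_mx_onM/bP31/bounded_mx_on_cst.
have bMPP : bounded_mx_on (T_ pr) (MPP pr fn).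
  apply: bounded_mx_onM; first exact: bounded_mx_on_cst.
  by apply: bounded_mx_onD => //; exact: bounded_mx_onN.
(* The common shape of [A0 - M0 P11], [F0 - M0 P12], [a1] and [A22]. *)
have bsub n p q (X : 'M[R]_(n, p)) (K : 'M[R]_(n, q)) (Y : R -> 'M[R]_(q, p)) :
    bounded_mx_on (T_ pr) Y -> bounded_mx_on (T_ pr) (fun t => X - K *m Y t).
  move=> bY; apply: bounded_mx_onD; first exact: bounded_mx_on_cst.
  exact/bounded_mx_onN/bounded_mx_onM/bY/bounded_mx_on_cst.
apply: bounded_mx_on_block.
- exact: bsub.
- by apply: bounded_mx_on_row; [exact: bounded_mx_on_cst|exact: bsub].
- apply: bounded_mx_on_col => //.
  by apply: bounded_mx_onM => //; exact: bounded_mx_on_cst.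
- apply: bounded_mx_on_block; last exact: bsub.
  + by apply: bounded_mx_on_mxdiag; exact: bsub.
  + apply: bounded_mx_onM; first exact: bounded_mx_on_cst.
    apply: bounded_mx_onD; first exact: bounded_mx_on_cst.
    exact: bounded_mx_onN.
  + exact: bounded_mx_on_cst.
Qed.

(** By linearity the difference of two solutions solves the same equation from initial value 0, with
    a coefficient bounded through [P] and [Px]. *)
Lemma equation_Psi_unique {R : realType} d d0 m m0 (pr : lq_params R d d0 m m0)
    (fn : lq_functions R d d0) N (Iobs : {set 'I_N})
    (Psi Psi' : R -> 'M[R]_(state_size d d0 Iobs)) :
  model_functions pr fn ->
  equation_Psi pr fn Psi -> equation_Psi pr fn Psi' ->
  {in `[0, T_ pr], Psi =1 Psi'}.
Proof.
move=> [[[dP _] _] [[dPx _] _] _ _ _] [dPsi Psi0] [dPsi' Psi'0].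
have [L A2L] := bounded_mx_on_uniform (bounded_bbA2 (pr := pr) (fn := fn)
  (Iobs := Iobs) (bounded_mx_on_derivative dP) (bounded_mx_on_derivative dPx)).
have dY := derivative_onB dPsi dPsi'.
have {}dY : derivative_on (T_ pr) (fun t => Psi t - Psi' t)
    (fun t => bbA2 pr fn Iobs t *m (Psi t - Psi' t)).
  by move: dY; congr derivative_on; apply/funext => t; rewrite mulmxBr.
move=> t t0T; apply/eqP; rewrite -subr_eq0; apply/eqP.
apply: (linear_ode_eq0 A2L dY) => //.
by rewrite Psi0 Psi'0 subrr.
Qed.

(** * The information matrices as functions of [Psi] and of the observation set *)

Lemma eq_integral_mx {R : realType} (a b : R) n p (X Y : R -> 'M[R]_(n, p)) :
  {in `[a, b], X =1 Y} -> integral_mx a b X = integral_mx a b Y.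
Proof.
move=> XY; apply/matrixP => i j; rewrite !mxE /Rintegral; congr fine.
by apply: eq_integral => u; rewrite inE /= => uab; rewrite XY.
Qed.

(** [H0] and [Sigma0] at step [s] evaluate [Psi] only on the cell from [t s] to [t s.+1], which lies
    between [t 0] and [t k] because the grid is monotone. *)
Lemma eq_effective_information {R : realType} d d0 m m0 (pr : lq_params R d d0 m m0)
    (fn : lq_functions R d d0) N (Iobs : {set 'I_N})
    (Psi Psi' : R -> 'M[R]_(state_size d d0 Iobs)) k (t : nat -> R) :
  (forall s, (s < k)%N -> t s <= t s.+1) ->
  {in `[t 0%N, t k], Psi =1 Psi'} ->
  effective_information pr fn Psi k t = effective_information pr fn Psi' k t.
Proof.
move=> t_nd PsiE.
(* The grid is known to increase only up to index [k], so the induction carries [s <= k]. *)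
have t_le r s : (r <= s <= k)%N -> t r <= t s.
  move=> /andP[]; elim: s => [|s IHs]; first by rewrite leqn0 => /eqP ->.
  rewrite leq_eqVlt => /predU1P[->//|]; rewrite ltnS => rs sk.
  by rewrite (le_trans (IHs rs (ltnW sk)))// t_nd.
have infoE : information pr fn Psi k t = information pr fn Psi' k t.
  apply: eq_bigr => s _.
  have PsiE' : {in `[t s, t s.+1], Psi =1 Psi'}.
    move=> u; rewrite in_itv /= => /andP[su us].
    apply: PsiE; rewrite in_itv /= (le_trans _ su) ?(le_trans us)//.
      by apply: t_le; rewrite ltn_ord /=.
    by apply: t_le; rewrite leq0n ltnW.
  have PsiSE : Psi (t s.+1) = Psi' (t s.+1).
    by apply: PsiE'; rewrite in_itv /= lexx t_nd.
  have HE : H0 pr fn Psi t s = H0 pr fn Psi' t s.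
    rewrite /H0 PsiSE; congr (_ *m _).
    by apply: eq_integral_mx => u us; rewrite PsiE'.
  have SigmaE : Sigma0 pr Psi t s = Sigma0 pr Psi' t s.
    rewrite /Sigma0 PsiSE.
    apply: (congr1 (fun S => Psi' (t s.+1) *m S *m (Psi' (t s.+1))^T)).
    by apply: eq_integral_mx => u us; rewrite PsiE'.
  by rewrite HE SigmaE.
by rewrite /effective_information /info_theta_theta /info_eta_theta
  /info_theta_eta /info_eta_eta infoE.
Qed.

(** The types of [Psi] and [Psi'] are equal only through the equality of cardinalities. The
    existential supplies [Psi'] at the type belonging to [Iobs], where it can be compared with
    [Psi]. *)
Lemma relabel_observation_set {R : realType} d d0 m m0 (pr : lq_params R d d0 m m0)
    (fn : lq_functions R d d0) N (Iobs Iobs' : {set 'I_N})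
    (Psi' : R -> 'M[R]_(state_size d d0 Iobs')) k (t : nat -> R) :
  #|Iobs| = #|Iobs'| -> equation_Psi pr fn Psi' ->
  exists2 Psi : R -> 'M[R]_(state_size d d0 Iobs), equation_Psi pr fn Psi &
    effective_information pr fn Psi k t = effective_information pr fn Psi' k t.
Proof.
move=> card_eq dPsi'.
rewrite /effective_information /info_theta_theta /info_eta_theta /info_theta_eta
  /info_eta_eta /information /H0 /Sigma0 /S_theta /S_eta /bbK0 /bbD0
  /equation_Psi /bbA2 /Iq /diag_obs /error_size /noise_size /state_size /obs_size.
(* Every dimension is now a function of [#|Iobs|], so this rewriting identifies
   the two matrix types without casts. *)
rewrite card_eq.
by exists Psi'.
Qed.

Unset Implicit Arguments.

Theorem proposition6p1 (R : realType) (d d0 m m0 : nat)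
    (pr : lq_params R d d0 m m0) (fn : lq_functions R d d0)
    (hpr : admissible_params pr) (hfn : model_functions pr fn)
    (k : nat) (t : nat -> R) (tau : R)
    (ht0 : t 0%N = 0)
    (ht : forall s : nat, (s < k)%N -> t s < t s.+1)
    (htk : t k = tau) (htau : tau < T_ pr)
    (N q : nat) (Iobs Iobs' : {set 'I_N})
    (hq : #|Iobs| = q) (hq' : #|Iobs'| = q)
    (Psi : R -> 'M[R]_(state_size d d0 Iobs))
    (Psi' : R -> 'M[R]_(state_size d d0 Iobs'))
    (hPsi : equation_Psi pr fn Psi)
    (hPsi' : equation_Psi pr fn Psi')
    (hinfo : nondegenerate_information pr fn Psi k t)
    (hinfo' : nondegenerate_information pr fn Psi' k t) :
  effective_information pr fn Psi k t = effective_information pr fn Psi' k t.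
Proof.
(* From here both functions solve the equation of the same set [Iobs]. *)
have [Psi2 dPsi2 <-] := relabel_observation_set k t (etrans hq (esym hq')) hPsi'.
apply: eq_effective_information => [s sk|u]; first exact/ltW/ht.
(* The grid spans [0, tau], which lies in [0, T], where uniqueness holds. *)
rewrite ht0 htk in_itv /= => /andP[u0 utau].
apply: (equation_Psi_unique hfn) => //.
by rewrite in_itv /= u0 (le_trans utau (ltW htau)).
Qed.
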